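(* Let $\mathbb C=(A,\mathcal C)$ be a proto-precontact algebra and let $\overline{\mathcal C}=(A\times A)\setminus\mathcal C$. Let $\rhd a=\bigvee\{b\in A\mid a\,\overline{\mathcal C}\,b\}$ and $\blacktriangleright a=\bigvee\{b\in A\mid b\,\overline{\mathcal C}\,a\}$ (joins in $A^\delta$), extended to $A^\delta$ as $\rhd^\pi,\blacktriangleright^\pi$ (superscripts omitted). Inequalities are in $A^\delta$, with $a,b$ ranging over $A$. 1. If $\mathbb C$ is antitone, then (i) $\overline{\mathcal C}\subseteq\,\le$ iff $\rhd a\le a$ for all $a$. (ii) $\le\,\subseteq\overline{\mathcal C}$ iff $a\le\rhd a$ for all $a$. (iii) $\overline{\mathcal C}\subseteq\,\ge$ iff $\blacktriangleright a\le a$ for all $a$. (iv) $\ge\,\subseteq\overline{\mathcal C}$ iff $a\le\blacktriangleright a$ for all $a$. (v) (for $A$ bounded) (NS) holds iff $a\wedge\rhd a\le\bot$ for all $a$. (vi) (for $A$ a bounded join-semilattice) (SFN) holds iff $\top\le a\vee\rhd a$ for all $a$. 2. If $\mathbb C$ is a precontact algebra, then the conditions in each of the following lists are equivalent (inequalities being required for all $a\in A$): (i) $\overline{\mathcal C}^{-1}\circ\overline{\mathcal C}\subseteq\overline{\mathcal C}$; $\rhd a\le\rhd\rhd a$; $\rhd a\le\blacktriangleright\rhd a$; $\overline{\mathcal C}^{-1}\circ\overline{\mathcal C}\subseteq\overline{\mathcal C}^{-1}$. (ii) $\overline{\mathcal C}^{-1}\circ\overline{\mathcal C}\subseteq\overline{\mathcal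 C}$; $\blacktriangleright a\le\blacktriangleright\blacktriangleright a$; $\blacktriangleright a\le\rhd\blacktriangleright a$; $\overline{\mathcal C}^{-1}\circ\overline{\mathcal C}\subseteq\overline{\mathcal C}^{-1}$. (iii) $\overline{\mathcal C}\circ\overline{\mathcal C}\subseteq\overline{\mathcal C}$; $\blacktriangleright a\le\blacktriangleright\rhd a$; $\rhd a\le\rhd\blacktriangleright a$; $\overline{\mathcal C}^{-1}\circ\overline{\mathcal C}^{-1}\subseteq\overline{\mathcal C}^{-1}$. (iv) $\overline{\mathcal C}\circ\overline{\mathcal C}\subseteq\overline{\mathcal C}^{-1}$; $\rhd a\le\blacktriangleright\blacktriangleright a$; $\blacktriangleright a\le\rhd\rhd a$; $\overline{\mathcal C}^{-1}\circ\overline{\mathcal C}^{-1}\subseteq\overline{\mathcal C}$. 3. If $\mathbb C$ is a precontact algebra and $A$ is a lattice, the following are equivalent: $\overline{\mathcal C}\subseteq\overline{\mathcal C}^{-1}$; $\overline{\mathcal C}^{-1}\subseteq\overline{\mathcal C}$; $\rhd a\le\blacktriangleright a$ for all $a$; $a\le\rhd\rhd a$ for all $a$; $\blacktriangleright a\le\rhd a$ for all $a$; $a\le\blacktriangleright\blacktriangleright a$ for all $a$. 4. If $\mathbb C$ is a precontact algebra and $A$ is also a meet-semilattice, then (CMO) holds iff $\rhd a\le\rhd(a\wedge\rhd a)$ for all $a$. 5. If $\mathbb C$ is a precontact algebra and $A$ is a distributive lattice, then (i) (ALT)$^{\rhd}$ holds iff $\top\le\rhd a\vee\rhd\rhd a$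 for all $a$; (ii) (ALT)$^{\blacktriangleright}$ holds iff $\top\le\blacktriangleright a\vee\blacktriangleright\blacktriangleright a$ for all $a$. 6. If $\mathbb C$ is a precontact algebra and $A$ is a Heyting algebra, then ($\vee\wedge$) holds iff $\rhd(a\vee b)\wedge(b\to\rhd a)\le a\to\blacktriangleright b$ for all $a,b$.
   Context: Canonical extension. For a poset $A$, $A^\delta$ is a complete lattice containing $A$ as a subposet. $k\in A^\delta$ is closed ($k\in K(A^\delta)$) if $k=\bigwedge F$ for some nonempty down-directed $F\subseteq A$; $o$ is open ($o\in O(A^\delta)$) if $o=\bigvee I$ for some nonempty up-directed $I\subseteq A$. Denseness: every element of $A^\delta$ is a join of closed elements and a meet of open elements. Compactness: if $F\subseteq A$ is nonempty down-directed, $I\subseteq A$ nonempty up-directed and $\bigwedge F\le\bigvee I$, then $a\le b$ for some $a\in F$, $b\in I$. $A^\delta$ exists and is unique up to isomorphism fixing $A$. A proto-precontact algebra is a pair $(A,\mathcal C)$ with $A$ a poset and $\mathcal C\subseteq A\times A$. Conditions (free variables universally quantified): (SB)$^\rhd$ $\exists b(b\,\overline{\mathcal C}\,a)$; (SF)$^\rhd$ $\exists b(a\,\overline{\mathcal C}\,b)$; (SI)$^\rhd$ $b\,\overline{\mathcal C}\,c\ \&\ a\le b\Rightarrow a\,\overline{\mathcal C}\,c$; (WO)$^\rhd$ $a\,\overline{\mathcal C}\,c\ \&\ b\le c\Rightarrow a\,\overline{\mathcal C}\,b$; (DD)$^\rhd$ $a\,\overline{\mathcal C}\,x_1\ \&\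 a\,\overline{\mathcal C}\,x_2\Rightarrow\exists x(x_1\le x\ \&\ x_2\le x\ \&\ a\,\overline{\mathcal C}\,x)$; (UD)$^\rhd$ $a_1\,\overline{\mathcal C}\,x\ \&\ a_2\,\overline{\mathcal C}\,x\Rightarrow\exists a(a_1\le a\ \&\ a_2\le a\ \&\ a\,\overline{\mathcal C}\,x)$. $\mathbb C$ is antitone if it satisfies these six conditions; then $\rhd a$ and $\blacktriangleright a$ are open for each $a\in A$. A precontact algebra is an antitone proto-precontact algebra with $A$ a bounded join-semilattice (bottom $\bot$, top $\top$) which moreover satisfies $\bot\,\overline{\mathcal C}\,\top$, $\top\,\overline{\mathcal C}\,\bot$, (AND)$^\rhd$ $a\,\overline{\mathcal C}\,b\ \&\ a\,\overline{\mathcal C}\,c\Rightarrow a\,\overline{\mathcal C}\,(b\vee c)$ and (OR)$^\rhd$ $a\,\overline{\mathcal C}\,c\ \&\ b\,\overline{\mathcal C}\,c\Rightarrow(a\vee b)\,\overline{\mathcal C}\,c$. Extensions: for $f\in\{\rhd,\blacktriangleright\}$, $f^\pi k=\bigvee\{f a\mid a\in A,k\le a\}$ for $k$ closed and $f^\pi u=\bigwedge\{f^\pi k\mid k\in K(A^\delta),k\le u\}$ for $u\in A^\delta$. In item 6, for $u,v\in A^\delta$, $u\to v$ is the largest $w\in A^\delta$ with $u\wedge w\le v$. Relational composition is read left to right: $x\,(R\circ S)\,y$ iff $x\,R\,z$ and $z\,S\,y$ for some $z$; $R^{-1}$ is the converse relation. Further conditions: (NS) $a\,\overline{\mathcal C}\,a\Rightarrow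 a\le\bot$. (SFN) $\forall a\exists b(a\,\overline{\mathcal C}\,b\ \&\ \top\le a\vee b)$. (ALT)$^\rhd$ $a\,\overline{\mathcal C}\,b\Rightarrow\exists c\exists d(\top\le c\vee d\ \&\ a\,\overline{\mathcal C}\,c\ \&\ b\,\overline{\mathcal C}\,d)$. (ALT)$^{\blacktriangleright}$ $b\,\overline{\mathcal C}\,a\Rightarrow\exists c\exists d(\top\le c\vee d\ \&\ c\,\overline{\mathcal C}\,a\ \&\ d\,\overline{\mathcal C}\,b)$. (CMO) $a\,\overline{\mathcal C}\,b\ \&\ a\,\overline{\mathcal C}\,c\Rightarrow(a\wedge c)\,\overline{\mathcal C}\,b$. ($\vee\wedge$) $(a\vee y)\,\overline{\mathcal C}\,x\ \&\ a\,\overline{\mathcal C}\,(x\wedge y)\Rightarrow(a\wedge x)\,\overline{\mathcal C}\,y$. *)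

(* Defs.v *)
From mathcomp Require Import all_boot all_order.
From mathcomp Require Import boolp classical_sets.
Set Implicit Arguments.
Unset Strict Implicit.
Unset Printing Implicit Defensive.
Import Order.Theory.
Local Open Scope classical_set_scope.
Local Open Scope order_scope.

Section CanonicalExtension.
Variables (d : Order.disp_t) (A : porderType d).

Definition down_directed (F : set A) :=
  forall a b, F a -> F b -> exists2 c, F c & c <= a /\ c <= b.

Definition up_directed (I : set A) :=
  forall a b, I a -> I b -> exists2 c, I c & a <= c /\ b <= c.

Variables (d' : Order.disp_t) (L : tbLatticeType d').

(* The join and the meet of [S], whenever they exist.  The library operators
   treat the empty family apart, hence the explicit [\bot] and [\top]. *)
Definition csup (S : set L) : L := supremum \bot S.
Definition cinf (S : set L) : L := infimum \top S.

Definition complete_lattice :=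
  forall S : set L, supremums S !=set0 /\ infimums S !=set0.

Variable e : A -> L.

Definition closed_elt (k : L) :=
  exists F : set A, [/\ F !=set0, down_directed F & k = cinf (e @` F)].

Definition open_elt (o : L) :=
  exists I : set A, [/\ I !=set0, up_directed I & o = csup (e @` I)].

Definition ce_dense :=
  forall u : L,
    (exists2 S : set L, (forall k, S k -> closed_elt k) & u = csup S) /\
    (exists2 S : set L, (forall o, S o -> open_elt o) & u = cinf S).

Definition ce_compact :=
  forall F I : set A,
    F !=set0 -> down_directed F -> I !=set0 -> up_directed I ->
    cinf (e @` F) <= csup (e @` I) ->
    exists a b, [/\ F a, I b & a <= b].

(* [L], with [A] sitting in it along [e], is the canonical extension of [A]. *)
Definition canonical_extension :=
  [/\ complete_lattice, {mono e : a b / a <= b}, ce_dense & ce_compact].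

(* [pi_ext f u] is taken at an arbitrary [u]; at a closed [u] it agrees with
   [pi_closed f u], because the latter is antitone in [u]. *)
Definition pi_closed (f : A -> L) (k : L) : L :=
  csup (f @` [set a | k <= e a]).

Definition pi_ext (f : A -> L) (u : L) : L :=
  cinf (pi_closed f @` [set k | closed_elt k /\ k <= u]).

End CanonicalExtension.

Section RelativePseudocomplement.
Variables (d : Order.disp_t) (L : latticeType d).

Definition is_himp (u v w : L) :=
  u `&` w <= v /\ forall w', u `&` w' <= v -> w' <= w.

(* The largest [w] with [u `&` w <= v]; the default [u] is never reached when
   such a [w] exists. *)
Definition himp (u v : L) : L := xget u [set w | is_himp u v w].

End RelativePseudocomplement.

Definition is_heyting (d : Order.disp_t) (A : tbLatticeType d) :=
  forall a b : A, exists c, is_himp a b c.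

Section Relations.
Variable T : Type.

(* Left to right, whereas the library's [S \; R] runs right to left. *)
Definition rcomp (R S : set (T * T)) : set (T * T) := (S \; R)%relation.

Definition rconv (R : set (T * T)) : set (T * T) := (R^-1)%relation.

Definition Cbar (C : set (T * T)) : set (T * T) := (~` C)%classic.

End Relations.

Section ProtoPrecontact.
Variables (d : Order.disp_t) (A : porderType d) (C : set (A * A)).

Definition le_rel : set (A * A) := [set xy | xy.1 <= xy.2].
Definition ge_rel : set (A * A) := [set xy | xy.1 >= xy.2].

Definition SB := forall a, exists b, Cbar C (b, a).

Definition SF := forall a, exists b, Cbar C (a, b).

Definition SI := forall a b c, Cbar C (b, c) -> a <= b -> Cbar C (a, c).

Definition WO := forall a b c, Cbar C (a, c) -> b <= c -> Cbar C (a, b).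

Definition DD := forall a x1 x2, Cbar C (a, x1) -> Cbar C (a, x2) ->
  exists x, [/\ x1 <= x, x2 <= x & Cbar C (a, x)].

Definition UD := forall a1 a2 x, Cbar C (a1, x) -> Cbar C (a2, x) ->
  exists a, [/\ a1 <= a, a2 <= a & Cbar C (a, x)].

Definition antitone := [/\ SB /\ SF, SI, WO, DD & UD].

Variables (d' : Order.disp_t) (L : tbLatticeType d') (e : A -> L).

Definition rhd (a : A) : L := csup (e @` [set b | Cbar C (a, b)]).
Definition brhd (a : A) : L := csup (e @` [set b | Cbar C (b, a)]).

Definition rhd_pi : L -> L := pi_ext e rhd.
Definition brhd_pi : L -> L := pi_ext e brhd.

End ProtoPrecontact.

Definition NS d (A : tbPOrderType d) (C : set (A * A)) :=
  forall a : A, Cbar C (a, a) -> a <= \bot.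

Section Precontact.
Variables (d : Order.disp_t) (A : tbJoinSemilatticeType d) (C : set (A * A)).

Definition AND := forall a b c,
  Cbar C (a, b) -> Cbar C (a, c) -> Cbar C (a, b `|` c).

Definition OR := forall a b c,
  Cbar C (a, c) -> Cbar C (b, c) -> Cbar C (a `|` b, c).

Definition precontact :=
  [/\ antitone C, Cbar C (\bot, \top), Cbar C (\top, \bot), AND & OR].

Definition SFN := forall a, exists b, Cbar C (a, b) /\ \top <= a `|` b.

Definition ALT_rhd := forall a b, Cbar C (a, b) ->
  exists c d, [/\ \top <= c `|` d, Cbar C (a, c) & Cbar C (b, d)].

Definition ALT_brhd := forall a b, Cbar C (b, a) ->
  exists c d, [/\ \top <= c `|` d, Cbar C (c, a) & Cbar C (d, b)].

End Precontact.

Section PrecontactLattice.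
Variables (d : Order.disp_t) (A : tbLatticeType d) (C : set (A * A)).

Definition CMO := forall a b c,
  Cbar C (a, b) -> Cbar C (a, c) -> Cbar C (a `&` c, b).

Definition join_meet_cond := forall a x y,
  Cbar C (a `|` y, x) -> Cbar C (a, x `&` y) -> Cbar C (a `&` x, y).

End PrecontactLattice.

(* Main.v *)
(* Since [C] is antitone, [{b | Cbar C (a, b)}] is an ideal of [A]; by compactness
   [e b] lies below the join of an ideal iff [b] belongs to it, and the extension
   of [rhd] sends the join of an ideal [I] to the meet of the [rhd b] for [b] in
   [I].  Meets and joins of two joins of ideals, and relative pseudocomplements of
   elements of [A] into them, are again joins of explicit ideals, so that each
   inequality in the canonical extension unfolds to a first-order condition on
   [Cbar C]. *)
Require Import Defs.
From mathcomp Require Import all_boot all_order.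
From mathcomp Require Import boolp classical_sets.
Set Implicit Arguments.
Unset Strict Implicit.
Unset Printing Implicit Defensive.
Import Order.Theory.
Local Open Scope classical_set_scope.
Local Open Scope order_scope.

(** * Universal properties of joins and meets in a complete lattice *)

Section CompleteLattice.
Context {d : Order.disp_t} {L : tbLatticeType d}.
Hypothesis L_complete : complete_lattice L.

Lemma csup_le_iff (S : set L) (u : L) :
  csup S <= u <-> forall x, S x -> x <= u.
Proof.
have [supS _] := L_complete S; rewrite /csup /supremum.
case: eqVneq => [->|_]; first by split=> // _; exact: le0x.
have [ub lub] := xgetPex \bot supS; split=> [Su x Sx|]; last exact: lub.
by apply: le_trans Su; exact: ub.
Qed.

Lemma le_csup (S : set L) (x : L) : S x -> x <= csup S.
Proof. by move: x; apply/csup_le_iff. Qed.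

Lemma le_cinf_iff (S : set L) (u : L) :
  u <= cinf S <-> forall x, S x -> u <= x.
Proof.
have [_ infS] := L_complete S; rewrite /cinf /infimum.
case: eqVneq => [->|_]; first by split=> // _; exact: lex1.
have [lb glb] := xgetPex \top infS; split=> [uS x Sx|]; last exact: glb.
by apply: le_trans uS _; exact: lb.
Qed.

Lemma cinf_le (S : set L) (x : L) : S x -> cinf S <= x.
Proof. by move: x; apply/le_cinf_iff. Qed.

End CompleteLattice.

(** * Ideals, and the prime ideal theorem for distributive lattices *)

Definition ideal (d : Order.disp_t) (A : porderType d) (I : set A) :=
  [/\ I !=set0, up_directed I & forall a b, I b -> a <= b -> I a].

Lemma ideal_principal (d : Order.disp_t) (A : porderType d) (a : A) :
  ideal [set b | b <= a].
Proof.
split; first by exists a => /=.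
  by move=> b c /= ba ca; exists a => /=.
by move=> b c /= ca bc; apply: le_trans ca.
Qed.

Lemma join_ideal (d : Order.disp_t) (A : joinSemilatticeType d) (I : set A) :
  I !=set0 -> (forall a b, I a -> I b -> I (a `|` b)) ->
  (forall a b, I b -> a <= b -> I a) -> ideal I.
Proof.
move=> I0 IU Idown; split=> // a b Ia Ib.
by exists (a `|` b); [exact: IU|rewrite leUl leUr].
Qed.

Lemma ideal_join (d : Order.disp_t) (A : joinSemilatticeType d) (I : set A)
  (a b : A) : ideal I -> I a -> I b -> I (a `|` b).
Proof.
move=> [_ Idir Idown] Ia Ib; have [c Ic [ac bc]] := Idir _ _ Ia Ib.
by apply: Idown Ic _; rewrite leUx ac bc.
Qed.

Lemma idealI (d : Order.disp_t) (A : bLatticeType d) (I J : set A) :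
  ideal I -> ideal J -> ideal (I `&` J)%classic.
Proof.
move=> iI iJ; have [[i Ii] _ Idown] := iI; have [[j Jj] _ Jdown] := iJ.
apply: join_ideal.
- exists (i `&` j).
  by split; [apply: Idown Ii _; apply: leIl|apply: Jdown Jj _; apply: leIr].
- by move=> a b [Ia Ja] [Ib Jb]; split; apply: ideal_join.
- by move=> a b [Ib Jb] ab; split; [apply: Idown Ib ab|apply: Jdown Jb ab].
Qed.

(* Zorn is applied to the sets [J] such that [I `|` J] is a proper ideal, so that
   the union of the empty chain qualifies. *)
Lemma prime_ideal (d : Order.disp_t) (A : tbDistrLatticeType d) (I : set A) :
  ideal I -> ~ I \top ->
  exists J : set A, [/\ I `<=` J, ideal J, ~ J \top &
    forall a b, J (a `&` b) -> J a \/ J b].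
Proof.
move=> iI I1; pose P (J : set A) := ideal (I `|` J)%classic /\ ~ (I `|` J)%classic \top.
have [F FP Fchain|J [[iJ J1] Jmax]] := @Zorn_bigcup A P.
  split; last first.
    case=> // -[X FX X1]; have [_] := FP _ FX; apply; by right.
  have [[i Ii] Idir Idown] := iI.
  have sub X : F X -> (I `|` X `<=` I `|` \bigcup_(X in F) X)%classic.
    by move=> FX x [|Xx]; [left|right; exists X].
  apply: join_ideal; first by exists i; left.
    move=> a b [Ia|[X FX Xa]] [Ib|[Y FY Yb]].
    - by left; apply: ideal_join.
    - by apply: (sub Y) => //; apply: ideal_join (FP _ FY).1 _ _; [left|right].
    - by apply: (sub X) => //; apply: ideal_join (FP _ FX).1 _ _; [right|left].
    - have [XY|YX] := Fchain _ _ FX FY.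
      + by apply: (sub Y) => //; apply: ideal_join (FP _ FY).1 _ _; right; auto.
      + by apply: (sub X) => //; apply: ideal_join (FP _ FX).1 _ _; right; auto.
  move=> a b [Ib|[X FX Xb]] ab; first by left; apply: Idown Ib ab.
  apply: (sub X) => //; have [[_ _ down] _] := FP _ FX.
  by apply: down ab; right.
set K := (I `|` J)%classic in iJ J1; exists K; split=> //; first by move=> x; left.
have [[k0 Kk0] Kdir Kdown] := iJ.
(* Otherwise the ideal [J'] generated by [K] and [c] would be proper, and it would strictly extend
   the maximal [J], since it contains [c]. *)
have cover c : ~ K c -> exists2 k, K k & \top <= k `|` c.
  move=> Kc; apply: contrapT => noK.
  pose J' := [set x | exists2 k, K k & x <= k `|` c].
  have KJ' : K `<=` J' by move=> k Kk; exists k => //; apply: leUl.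
  have J'c : J' c by exists k0 => //; apply: leUr.
  have IJ' : (I `|` J' = J')%classic.
    by rewrite setUidr// => x Ix; apply: KJ'; left.
  apply: (Jmax J').
    split=> [x Jx|J'J]; first by apply: KJ'; right.
    by apply: Kc; right; apply: J'J.
  rewrite /P IJ'; split; last by case=> k Kk ck; apply: noK; exists k.
  apply: join_ideal; first by exists c.
    move=> x y [k Kk xk] [l Kl yl]; exists (k `|` l); first exact: ideal_join.
    by rewrite -[c]joinxx joinACA leU2.
  by move=> x y [k Kk yk] xy; exists k => //; apply: le_trans yk.
move=> a b Kab; apply: contrapT => /not_orP[/cover[k Kk ka] /cover[l Kl lb]].
apply: J1; apply: (Kdown _ ((k `|` l) `|` (a `&` b))).
  by apply: ideal_join => //; apply: ideal_join.
(* By distributivity this join is a meet of two elements, one above [k] joined with [a] and the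
   other above [l] joined with [b], so both are [\top]. *)
rewrite joinIr lexI; apply/andP; split.
  by apply: le_trans ka _; rewrite leU2 ?leUl.
by apply: le_trans lb _; rewrite leU2 ?leUr.
Qed.

(** * Consequences of denseness and compactness *)

Section CanonicalExtension.
Context {d : Order.disp_t} {A : porderType d} {d' : Order.disp_t}
  {L : tbLatticeType d'}.
Variable e : A -> L.
Hypothesis e_ce : canonical_extension e.

Let L_complete : complete_lattice L.
Proof. by case: e_ce. Qed.

Let e_mono : {mono e : a b / a <= b}.
Proof. by case: e_ce. Qed.

Lemma csup_image_le_iff (I : set A) (u : L) :
  csup (e @` I) <= u <-> forall a, I a -> e a <= u.
Proof.
split=> [/(csup_le_iff L_complete) Iu a Ia|Iu]; first by apply: Iu; exists a.
by apply/(csup_le_iff L_complete) => _ [a Ia <-]; exact: Iu.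
Qed.

Lemma le_csup_image (I : set A) (a : A) : I a -> e a <= csup (e @` I).
Proof. by move: a; apply/csup_image_le_iff. Qed.

Lemma closed_elt_image (a : A) : closed_elt e (e a).
Proof.
exists [set a]; split; first by exists a.
  by move=> _ _ -> ->; exists a.
by rewrite image_set1 /cinf /infimum; apply/le_anti/andP; split;
  [apply/(le_cinf_iff L_complete) => _ ->|apply: (cinf_le L_complete)].
Qed.

Lemma closed_le_csup (I : set A) (k : L) :
  I !=set0 -> up_directed I -> closed_elt e k -> k <= csup (e @` I) ->
  exists2 a, I a & k <= e a.
Proof.
have [_ _ _ comp] := e_ce.
move=> I0 Idir [F [F0 Fdir ->]] /(comp _ _ F0 Fdir I0 Idir)[a [b [Fa Ib ab]]].
exists b => //; apply: le_trans (_ : e a <= e b); last by rewrite e_mono.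
by apply: (cinf_le L_complete); exists a.
Qed.

Lemma le_csup_directed_iff (I : set A) (a : A) :
  I !=set0 -> up_directed I ->
  e a <= csup (e @` I) <-> exists2 b, I b & a <= b.
Proof.
move=> I0 Idir; split=> [/(closed_le_csup I0 Idir (closed_elt_image a))|].
  by case=> b Ib; rewrite e_mono; exists b.
case=> b Ib ab; apply: le_trans (le_csup_image Ib).
by rewrite e_mono.
Qed.

Lemma le_csup_ideal_iff (I : set A) (a : A) :
  ideal I -> e a <= csup (e @` I) <-> I a.
Proof.
move=> [I0 Idir Idown]; split; last exact: le_csup_image.
by case/(le_csup_directed_iff _ I0 Idir) => b Ib; apply: Idown.
Qed.

Lemma le_closed (u v : L) :
  (forall k, closed_elt e k -> k <= u -> k <= v) -> u <= v.
Proof.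
have [_ _ /(_ u)[[S Sclosed ->] _] _] := e_ce => Sv.
apply/(csup_le_iff L_complete) => k Sk; apply: Sv; first exact: Sclosed.
exact: le_csup.
Qed.

Lemma le_open (u v : L) :
  (forall o, open_elt e o -> v <= o -> u <= o) -> u <= v.
Proof.
have [_ _ /(_ v)[_ [S Sopen ->]] _] := e_ce => uS.
apply/(le_cinf_iff L_complete) => o So; apply: uS; first exact: Sopen.
exact: cinf_le.
Qed.

(** Closing a directed set downwards keeps its join, and compactness then turns comparison with the
    join into plain membership. *)
Lemma open_elt_ideal (o : L) :
  open_elt e o -> exists2 I : set A, ideal I & o = csup (e @` I).
Proof.
move=> [I [I0 Idir ->]]; pose J := [set a | exists2 b, I b & a <= b].
have IJ : I `<=` J by move=> a Ia; exists a.
exists J.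
  split; first by have [a Ia] := I0; exists a; apply: IJ.
    move=> a b [x Ix ax] [y Iy yb]; have [z Iz [xz yz]] := Idir _ _ Ix Iy.
    by exists z; [exact: IJ|split; [exact: le_trans xz|exact: le_trans yz]].
  by move=> a b [x Ix bx] ab; exists x => //; apply: le_trans bx.
apply/le_anti/andP; split; apply/csup_image_le_iff => a.
  by move=> /IJ; exact: le_csup_image.
by move=> ?; apply/le_csup_directed_iff.
Qed.

Lemma csup_principal (a : A) : csup (e @` [set b | b <= a]) = e a.
Proof.
apply/le_anti/andP; split; last by apply: le_csup_image => /=.
by apply/csup_image_le_iff => b /=; rewrite e_mono.
Qed.

(** [A] may lack meets: compactness against the principal ideals of [a] and [b] finds two members of
    the set defining [k], and directedness gives [c] below both. *)
Lemma closed_le_meet (k : L) (a b : A) :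
  closed_elt e k -> k <= e a -> k <= e b ->
  exists c, [/\ k <= e c, c <= a & c <= b].
Proof.
have [_ _ _ comp] := e_ce => -[F [F0 Fdir ->]].
have mem x : cinf (e @` F) <= e x -> exists2 f, F f & f <= x.
  have [I0 Idir _] := ideal_principal x.
  rewrite -csup_principal => /(comp _ _ F0 Fdir I0 Idir)[f [y [Ff /= yx fy]]].
  by exists f => //; apply: le_trans yx.
move=> /mem[f Ff fa] /mem[g Fg gb]; have [c Fc [cf cg]] := Fdir _ _ Ff Fg.
exists c; split; [|exact: le_trans fa|exact: le_trans gb].
by apply: (cinf_le L_complete); exists c.
Qed.

(** By denseness it suffices to test closed elements; one lying below both joins lies below some
    member of each ideal, hence below a common member. *)
Lemma meet_csup_ideal (I J : set A) : ideal I -> ideal J ->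
  csup (e @` I) `&` csup (e @` J) = csup (e @` (I `&` J)%classic).
Proof.
move=> [I0 Idir Idown] [J0 Jdir Jdown]; apply/le_anti/andP; split; last first.
  apply/csup_image_le_iff => a [Ia Ja].
  by rewrite lexI !le_csup_image.
apply: le_closed => k kclosed; rewrite lexI => /andP[].
move=> /(closed_le_csup I0 Idir kclosed)[i Ii ki].
move=> /(closed_le_csup J0 Jdir kclosed)[j Jj kj].
have [c [kc ci cj]] := closed_le_meet kclosed ki kj.
apply: le_trans kc _; apply: le_csup_image.
by split; [apply: Idown Ii ci|apply: Jdown Jj cj].
Qed.

(** By compactness each closed [k] below the join of [I] is below some [e a] with [a] in [I], and
    then [f a] is one of the joinands of [pi_closed f k]. So only the elements [e a] matter in the
    meet. *)
Lemma pi_ext_csup_iff (f : A -> L) (I : set A) (u : L) :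
  {homo f : a b /~ a <= b} -> I !=set0 -> up_directed I ->
  u <= pi_ext e f (csup (e @` I)) <-> forall a, I a -> u <= f a.
Proof.
move=> f_anti I0 Idir; split=> [uf a Ia|uf].
  apply: le_trans uf _; apply: le_trans (_ : pi_closed e f (e a) <= _).
    apply: (cinf_le L_complete); exists (e a) => //.
    by split; [exact: closed_elt_image|exact: le_csup_image].
  apply/(csup_le_iff L_complete) => _ [b /= ab <-].
  by apply: f_anti; rewrite -e_mono.
apply/(le_cinf_iff L_complete) => _ [k [kclosed kI] <-].
have [a Ia ka] := closed_le_csup I0 Idir kclosed kI.
apply: le_trans (uf _ Ia) _.
by apply: (le_csup L_complete); exists a.
Qed.

(** * The operation [rhd] on [A] and on joins of ideals *)

Section Rhd.
Variable C : set (A * A).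
Hypothesis C_antitone : antitone C.

Lemma ideal_rhd (a : A) : ideal [set b | Cbar C (a, b)].
Proof.
have [[_ hSF] _ hWO hDD _] := C_antitone.
split; [exact: hSF| |by move=> b c; apply: hWO].
by move=> b c /hDD/[apply] -[x [bx cx ax]]; exists x.
Qed.

Lemma le_rhd_iff (a b : A) : e b <= rhd C e a <-> Cbar C (a, b).
Proof. exact: (le_csup_ideal_iff _ (ideal_rhd a)). Qed.

Lemma rhd_le_iff (a : A) (u : L) :
  rhd C e a <= u <-> forall b, Cbar C (a, b) -> e b <= u.
Proof. exact: csup_image_le_iff. Qed.

Lemma rhd_anti : {homo rhd C e : a b /~ a <= b}.
Proof.
have [_ hSI _ _ _] := C_antitone.
by move=> a b ba; apply/rhd_le_iff => c /hSI/(_ ba)/le_rhd_iff.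
Qed.

Lemma meet_image_rhd (a : A) :
  e a `&` rhd C e a =
  csup (e @` ([set b | b <= a] `&` [set b | Cbar C (a, b)])%classic).
Proof.
rewrite -meet_csup_ideal ?csup_principal//; last exact: ideal_rhd.
exact: ideal_principal.
Qed.

Lemma le_rhd_pi_csup_iff (I : set A) (u : L) :
  I !=set0 -> up_directed I ->
  u <= rhd_pi C e (csup (e @` I)) <-> forall a, I a -> u <= rhd C e a.
Proof. exact: pi_ext_csup_iff rhd_anti. Qed.

Lemma Cbar_sub_ge_iff :
  Cbar C `<=` @ge_rel d A <-> forall a, rhd C e a <= e a.
Proof.
split=> [Cge a|rhd_le [a b] Cab].
  by apply/rhd_le_iff => b /Cge; rewrite e_mono.
by rewrite /ge_rel/= -e_mono (le_trans _ (rhd_le a))//; apply/le_rhd_iff.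
Qed.

(* If [Cab] and [Cbc] then [a <= b <= c], hence [Cbb] and [Cba], so that [a = b]:
   this is why the first item may pair [le_rel] with [rhd a <= a], which unfolds
   to an inclusion in [ge_rel]. *)
Lemma Cbar_sub_le_ge : Cbar C `<=` @le_rel d A -> Cbar C `<=` @ge_rel d A.
Proof.
have [[_ hSF] hSI hWO _ _] := C_antitone => Cle [a b] Cab.
have [c Cbc] := hSF b; have Cbb := hWO _ _ _ Cbc (Cle _ Cbc).
exact: (Cle (b, a)) (hWO _ _ _ Cbb (Cle _ Cab)).
Qed.

Lemma le_sub_Cbar_iff :
  @le_rel d A `<=` Cbar C <-> forall a, e a <= rhd C e a.
Proof.
have [_ hSI _ _ _] := C_antitone.
split=> [leC a|le_rhd [a b] /= ab]; first by apply/le_rhd_iff/leC; exact: lexx.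
by apply: hSI ab; apply/le_rhd_iff.
Qed.

End Rhd.

(* The operation [brhd C] is [rhd] of the converse relation, so that every fact
   about one of the two transfers to the other. *)
Lemma antitone_rconv (C : set (A * A)) : antitone C -> antitone (rconv C).
Proof.
move=> [[hSB hSF] hSI hWO hDD hUD]; split=> //.
- by move=> a b c Cb ab; apply: hWO Cb ab.
- by move=> a b c Cc bc; apply: hSI Cc bc.
- by move=> a x y Cx Cy; apply: hUD Cx Cy.
- by move=> a b x Ca Cb; apply: hDD Ca Cb.
Qed.

(** With [C] or its converse in each of the three places, this covers every inequality between [rhd]
    or [brhd] and a composite of two of them. *)
Lemma rhd_le_rhd_pi_rhd_iff (C C' C'' : set (A * A)) :
  antitone C -> antitone C' -> antitone C'' ->
  (forall a, rhd C e a <= rhd_pi C' e (rhd C'' e a)) <->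
  (forall a b c, Cbar C (a, b) -> Cbar C'' (a, c) -> Cbar C' (c, b)).
Proof.
move=> aC aC' aC''; have h a := ideal_rhd aC'' a.
split=> [H a b c Cab Cac|H a].
  have [I0 Idir _] := h a; apply/(le_rhd_iff aC').
  move/(le_rhd_pi_csup_iff aC' _ I0 Idir)/(_ c Cac): (H a).
  exact/le_trans/le_rhd_iff.
have [I0 Idir _] := h a; apply/(le_rhd_pi_csup_iff aC' _ I0 Idir) => c Cac.
by apply/rhd_le_iff => b Cab; apply/le_rhd_iff => //; apply: H Cab Cac.
Qed.

Lemma le_rhd_pi_rhd_iff (C C' : set (A * A)) :
  antitone C -> antitone C' ->
  (forall a, e a <= rhd_pi C e (rhd C' e a)) <->
  (forall a b, Cbar C' (a, b) -> Cbar C (b, a)).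
Proof.
move=> aC aC'; have h a := ideal_rhd aC' a.
split=> [H a b Cab|H a].
  have [I0 Idir _] := h a; apply/(le_rhd_iff aC).
  by move/(le_rhd_pi_csup_iff aC _ I0 Idir)/(_ b Cab): (H a).
have [I0 Idir _] := h a; apply/(le_rhd_pi_csup_iff aC _ I0 Idir) => c Cac.
by apply/le_rhd_iff => //; apply: H.
Qed.

Lemma rhd_le_rhd_iff (C C' : set (A * A)) :
  antitone C' -> (forall a, rhd C e a <= rhd C' e a) <-> Cbar C `<=` Cbar C'.
Proof.
move=> aC'; split=> [H [a b] Cab|H a].
  by apply/(le_rhd_iff aC')/(le_trans _ (H a)); exact: le_csup_image.
by apply/rhd_le_iff => b Cab; apply/le_rhd_iff => //; apply: H.
Qed.

End CanonicalExtension.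

(** * Binary joins of joins of ideals *)

Section JoinSemilattice.
Context {d : Order.disp_t} {A : joinSemilatticeType d} {d' : Order.disp_t}
  {L : tbLatticeType d'}.
Variable e : A -> L.
Hypothesis e_ce : canonical_extension e.

(** By denseness it suffices to test open elements; these are joins of ideals, and ideals are closed
    under binary joins. *)
Lemma image_join_le (a b : A) : e (a `|` b) <= e a `|` e b.
Proof.
apply: (le_open e_ce) => _ /(open_elt_ideal e_ce)[I iI ->].
rewrite leUx => /andP[/(le_csup_ideal_iff e_ce _ iI) Ia].
move/(le_csup_ideal_iff e_ce _ iI) => Ib.
by apply/(le_csup_ideal_iff e_ce) => //; apply: ideal_join.
Qed.

(** The set [K] is the ideal generated by [I] and [J]; its join bounds both joins, so [a] must
    belong to it. *)
Lemma le_join_csup_iff (I J : set A) (a : A) : ideal I -> ideal J ->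
  e a <= csup (e @` I) `|` csup (e @` J) <->
  exists i j, [/\ I i, J j & a <= i `|` j].
Proof.
move=> iI iJ; have [[i0 Ii0] _ Idown] := iI; have [[j0 Jj0] _ Jdown] := iJ.
have e_mono : {mono e : a b / a <= b} by case: e_ce.
split=> [aIJ|[i [j [Ii Jj aij]]]]; last first.
  apply: le_trans (_ : e (i `|` j) <= _); first by rewrite e_mono.
  by apply: le_trans (image_join_le _ _) _; rewrite leU2// le_csup_image.
pose K := [set x | exists i j, [/\ I i, J j & x <= i `|` j]].
have iK : ideal K.
  apply: join_ideal; first by exists i0; exists i0, j0; rewrite leUl.
    move=> x y [i [j [Ii Jj xij]]] [i' [j' [Ii' Jj' yij']]].
    exists (i `|` i'), (j `|` j'); split; try exact: ideal_join.
    by rewrite joinACA leU2.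
  move=> x y [i [j [Ii Jj yij]]] xy; exists i, j; split=> //.
  exact: le_trans yij.
suff : e a <= csup (e @` K) by move/(le_csup_ideal_iff e_ce _ iK).
apply: le_trans aIJ _; rewrite leUx; apply/andP; split.
  apply/(csup_image_le_iff e_ce) => i Ii; apply: (le_csup_image e_ce).
  by exists i, j0; rewrite leUl.
apply/(csup_image_le_iff e_ce) => j Jj; apply: (le_csup_image e_ce).
by exists i0, j; rewrite leUr.
Qed.

End JoinSemilattice.

(** * The ALT conditions through prime ideals *)

Section DistrLattice.
Context {d : Order.disp_t} {A : tbDistrLatticeType d} {d' : Order.disp_t}
  {L : tbLatticeType d'}.
Variable e : A -> L.
Hypothesis e_ce : canonical_extension e.

(* [L] is not known to be distributive, so the meet defining [rhd_pi] cannot be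
   pulled out of the join.  If an open [csup I] above the join were not above
   [\top], extend [I] to a prime ideal [J]: the meet of the complement of [J] lies
   below one of the two joinands, contradicting compactness. *)
Lemma ALT_rhd_iff (C : set (A * A)) : antitone C ->
  ALT_rhd C <-> forall a, e \top <= rhd C e a `|` rhd_pi C e (rhd C e a).
Proof.
move=> aC; have [[_ hSF] _ _ _ _] := aC; have iC := ideal_rhd aC.
split=> [alt a|H a b Cab]; last first.
  have [I0 Idir _] := iC a.
  have : e \top <= rhd C e a `|` rhd C e b.
    apply: le_trans (H a) _; rewrite leU2//.
    exact: (le_rhd_pi_csup_iff e_ce aC _ I0 Idir).1 (lexx _) _ Cab.
  by case/(le_join_csup_iff e_ce _ (iC a) (iC b)) => i [j []]; exists i, j.
apply: (le_open e_ce) => _ /(open_elt_ideal e_ce)[I iI ->].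
rewrite leUx => /andP[rhdI rhd_piI]; apply/(le_csup_ideal_iff e_ce _ iI).
apply: contrapT => /(prime_ideal iI)[J [IJ iJ J1 Jprime]].
have [J0 Jdir Jdown] := iJ.
(* Primeness makes the complement of [J] a filter; as it misses [I], compactness keeps its meet from
   lying below the join of [I]. *)
pose F := [set x | ~ J x].
have F0 : F !=set0 by exists \top.
have Fdir : down_directed F.
  move=> x y Fx Fy; exists (x `&` y); last by rewrite leIl leIr.
  by case/Jprime.
have FI : ~ cinf (e @` F) <= csup (e @` I).
  have [_ _ _ comp] := e_ce; have [I0 Idir _] := iI.
  case/(comp _ _ F0 Fdir I0 Idir) => f [i [Ff Ii fi]].
  by apply: Ff; apply: Jdown fi; apply: IJ.
have L_complete : complete_lattice L by case: e_ce.
have F_le x : F x -> cinf (e @` F) <= e x.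
  by move=> Fx; apply: (cinf_le L_complete); exists x.
(* If some such [c] lay outside [J], the meet of [F] would lie below [rhd C e a], hence below the
   join of [I]. *)
have CJ c : Cbar C (a, c) -> J c.
  move=> Cac; apply: contrapT => /F_le Fc; apply: FI.
  apply: le_trans rhdI; apply: le_trans Fc _.
  exact: (le_csup_image e_ce).
apply: FI; apply: le_trans rhd_piI.
have [I0 Idir _] := iC a.
(* Since [c] is in the proper ideal [J] and joins with [x] to [\top], [x] lies in [F], so the meet
   of [F] is below [rhd C e b]. *)
apply/(le_rhd_pi_csup_iff e_ce aC _ I0 Idir) => b /alt[c [x [cx /CJ Jc Cbx]]].
apply: le_trans (_ : e x <= _); last exact: (le_csup_image e_ce).
apply: F_le => Jx; apply: J1; apply: Jdown cx.
exact: ideal_join.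
Qed.

End DistrLattice.

(** * Relative pseudocomplements of elements of [A] into joins of ideals *)

Section HeytingAlgebra.
Context {d : Order.disp_t} {A : tbLatticeType d} {d' : Order.disp_t}
  {L : tbLatticeType d'}.
Variable e : A -> L.
Hypotheses (e_ce : canonical_extension e) (A_heyting : is_heyting A).

Lemma himpE (u v w : L) : is_himp u v w -> himp u v = w.
Proof.
move=> uvw; have [uvx xmax] := xgetPex u (ex_intro (is_himp u v) w uvw).
have [uvw' wmax] := uvw.
by apply/le_anti/andP; split; [exact: wmax|exact: xmax].
Qed.

(** Meet with [a] has a right adjoint, hence preserves joins. *)
Lemma heyting_meet_join_le (a b c : A) :
  a `&` (b `|` c) <= (a `&` b) `|` (a `&` c).
Proof.
have [x [ax xmax]] := A_heyting a ((a `&` b) `|` (a `&` c)).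
apply: le_trans ax; rewrite leI2// leUx.
by apply/andP; split; apply: xmax; rewrite ?leUl ?leUr.
Qed.

Lemma ideal_himp (I : set A) (a : A) : ideal I -> ideal [set b | I (a `&` b)].
Proof.
move=> iI; have [[i Ii] _ Idown] := iI; apply: join_ideal.
- by exists i; apply: Idown Ii _; apply: leIr.
- move=> b c Ib Ic; apply: Idown (heyting_meet_join_le _ _ _).
  exact: ideal_join.
- by move=> b c Ic bc; apply: Idown Ic _; rewrite leI2.
Qed.

(* In particular the relative pseudocomplement exists in [L], so [himp] does not
   take its default value here. *)
Lemma himp_image_csup (I : set A) (a : A) : ideal I ->
  himp (e a) (csup (e @` I)) = csup (e @` [set b | I (a `&` b)]).
Proof.
move=> iI; have [I0 Idir Idown] := iI.
have e_mono : {mono e : a b / a <= b} by case: e_ce.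
have L_complete : complete_lattice L by case: e_ce.
apply: himpE; split.
  rewrite -{1}(csup_principal e_ce a) meet_csup_ideal//; last 2 first.
  - exact: ideal_principal.
  - exact: ideal_himp.
  apply/(csup_image_le_iff e_ce) => b [/= ba Iab]; apply: (le_csup_image e_ce).
  by rewrite (meet_idPr ba) in Iab.
move=> w aw; apply: (le_closed e_ce) => _ [F [F0 Fdir ->]] Fw.
(* The meet of [G] lies below both [e a] and [w], hence below the join of [I]; compactness then puts
   the meet of [a] with some [f] of [F] into [I]. *)
pose G := [set a `&` f | f in F].
have G0 : G !=set0 by have [f Ff] := F0; exists (a `&` f), f.
have Gdir : down_directed G.
  move=> _ _ [f Ff <-] [g Fg <-]; have [h Fh [hf hg]] := Fdir _ _ Ff Fg.
  by exists (a `&` h); [exists h|rewrite !leI2].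
have GI : cinf (e @` G) <= csup (e @` I).
  apply: le_trans aw; rewrite lexI; apply/andP; split.
    have [f Ff] := F0; apply: le_trans (_ : e (a `&` f) <= _).
      by apply: (cinf_le L_complete); exists (a `&` f) => //; exists f.
    by rewrite e_mono leIl.
  apply: le_trans Fw; apply/(le_cinf_iff L_complete) => _ [f Ff <-].
  apply: le_trans (_ : e (a `&` f) <= _); last by rewrite e_mono leIr.
  by apply: (cinf_le L_complete); exists (a `&` f) => //; exists f.
have [_ _ _ comp] := e_ce.
have [_ [i [[f Ff <-] Ii fi]]] := comp _ _ G0 Gdir I0 Idir GI.
apply: le_trans (_ : e f <= _); first by apply: (cinf_le L_complete); exists f.
by apply: (le_csup_image e_ce); apply: Idown fi.
Qed.

End HeytingAlgebra.

(** * Correspondence between conditions on [Cbar C] and inequalities in the extension *)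

Theorem proposition5p3 :
  (* 1 (i)-(iv) *)
  (forall (d : Order.disp_t) (A : porderType d) (C : set (A * A))
     (d' : Order.disp_t) (L : tbLatticeType d') (e : A -> L),
     canonical_extension e -> antitone C ->
     [/\ Cbar C `<=` @le_rel d A <-> (forall a, rhd C e a <= e a),
         @le_rel d A `<=` Cbar C <-> (forall a, e a <= rhd C e a),
         Cbar C `<=` @ge_rel d A <-> (forall a, brhd C e a <= e a)
       & @ge_rel d A `<=` Cbar C <-> (forall a, e a <= brhd C e a)]) /\
  (* 1 (v) *)
  (forall (d : Order.disp_t) (A : tbPOrderType d) (C : set (A * A))
     (d' : Order.disp_t) (L : tbLatticeType d') (e : A -> L),
     canonical_extension e -> antitone C ->
     NS C <-> (forall a, e a `&` rhd C e a <= e \bot)) /\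
  (* 1 (vi) *)
  (forall (d : Order.disp_t) (A : tbJoinSemilatticeType d) (C : set (A * A))
     (d' : Order.disp_t) (L : tbLatticeType d') (e : A -> L),
     canonical_extension e -> antitone C ->
     SFN C <-> (forall a, e \top <= e a `|` rhd C e a)) /\
  (* 2 *)
  (forall (d : Order.disp_t) (A : tbJoinSemilatticeType d) (C : set (A * A))
     (d' : Order.disp_t) (L : tbLatticeType d') (e : A -> L),
     canonical_extension e -> precontact C ->
     [/\ [<-> rcomp (rconv (Cbar C)) (Cbar C) `<=` Cbar C;
              forall a, rhd C e a <= rhd_pi C e (rhd C e a);
              forall a, rhd C e a <= brhd_pi C e (rhd C e a);
              rcomp (rconv (Cbar C)) (Cbar C) `<=` rconv (Cbar C)],
         [<-> rcomp (rconv (Cbar C)) (Cbar C) `<=` Cbar C;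
              forall a, brhd C e a <= brhd_pi C e (brhd C e a);
              forall a, brhd C e a <= rhd_pi C e (brhd C e a);
              rcomp (rconv (Cbar C)) (Cbar C) `<=` rconv (Cbar C)],
         [<-> rcomp (Cbar C) (Cbar C) `<=` Cbar C;
              forall a, brhd C e a <= brhd_pi C e (rhd C e a);
              forall a, rhd C e a <= rhd_pi C e (brhd C e a);
              rcomp (rconv (Cbar C)) (rconv (Cbar C)) `<=` rconv (Cbar C)]
       & [<-> rcomp (Cbar C) (Cbar C) `<=` rconv (Cbar C);
              forall a, rhd C e a <= brhd_pi C e (brhd C e a);
              forall a, brhd C e a <= rhd_pi C e (rhd C e a);
              rcomp (rconv (Cbar C)) (rconv (Cbar C)) `<=` Cbar C]]) /\
  (* 3 *)
  (forall (d : Order.disp_t) (A : tbLatticeType d) (C : set (A * A))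
     (d' : Order.disp_t) (L : tbLatticeType d') (e : A -> L),
     canonical_extension e -> precontact C ->
     [<-> Cbar C `<=` rconv (Cbar C);
          rconv (Cbar C) `<=` Cbar C;
          forall a, rhd C e a <= brhd C e a;
          forall a, e a <= rhd_pi C e (rhd C e a);
          forall a, brhd C e a <= rhd C e a;
          forall a, e a <= brhd_pi C e (brhd C e a)]) /\
  (* 4 *)
  (forall (d : Order.disp_t) (A : tbLatticeType d) (C : set (A * A))
     (d' : Order.disp_t) (L : tbLatticeType d') (e : A -> L),
     canonical_extension e -> precontact C ->
     CMO C <-> (forall a, rhd C e a <= rhd_pi C e (e a `&` rhd C e a))) /\
  (* 5 *)
  (forall (d : Order.disp_t) (A : tbDistrLatticeType d) (C : set (A * A))
     (d' : Order.disp_t) (L : tbLatticeType d') (e : A -> L),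
     canonical_extension e -> precontact C ->
     (ALT_rhd C <->
        (forall a, e \top <= rhd C e a `|` rhd_pi C e (rhd C e a))) /\
     (ALT_brhd C <->
        (forall a, e \top <= brhd C e a `|` brhd_pi C e (brhd C e a)))) /\
  (* 6 *)
  (forall (d : Order.disp_t) (A : tbLatticeType d) (C : set (A * A))
     (d' : Order.disp_t) (L : tbLatticeType d') (e : A -> L),
     canonical_extension e -> precontact C -> is_heyting A ->
     join_meet_cond C <->
       (forall a b : A,
          rhd C e (a `|` b) `&` himp (e b) (rhd C e a)
            <= himp (e a) (brhd C e b))).
Proof.
split=> [d A C d' L e e_ce aC|].
  have aC' := antitone_rconv aC.
  have geC : Cbar C `<=` @le_rel d A <-> Cbar C `<=` @ge_rel d A.
    split; first exact: Cbar_sub_le_ge.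
    (* Passing to the converse relation exchanges [le_rel] and [ge_rel], so the reverse implication
       is [Cbar_sub_le_ge] for [rconv C]. *)
    move=> Cge; suff : Cbar (rconv C) `<=` @ge_rel d A.
      by move=> H [a b] /(H (b, a)).
    by apply: Cbar_sub_le_ge => // -[a b] /(Cge (b, a)).
  split.
  - exact: iff_trans geC (Cbar_sub_ge_iff e_ce aC).
  - exact: le_sub_Cbar_iff.
  - apply: iff_trans (iff_trans _ (Cbar_sub_ge_iff e_ce aC')).
      exact: iff_sym geC.
    by split=> H [a b] /(H (b, a)).
  - apply: iff_trans (le_sub_Cbar_iff e_ce aC').
    by split=> H [a b] /(H (b, a)).
split=> [d A C d' L e e_ce aC|].
  have e_mono : {mono e : a b / a <= b} by case: e_ce.
  have [_ hSI _ _ _] := aC.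
  split=> [ns a|H a Caa].
    rewrite meet_image_rhd//; apply/(csup_image_le_iff e_ce) => b [/= ba Cab].
    by rewrite e_mono; apply: ns; apply: hSI Cab ba.
  rewrite -e_mono; apply: le_trans (H a); rewrite meet_image_rhd//.
  by apply: (le_csup_image e_ce); split=> /=.
split=> [d A C d' L e e_ce aC|].
  have iC := ideal_rhd aC.
  have h a : e \top <= e a `|` rhd C e a <->
      exists i j, [/\ i <= a, Cbar C (a, j) & \top <= i `|` j].
    rewrite -{1}(csup_principal e_ce a).
    exact: le_join_csup_iff (ideal_principal a) (iC a).
  split=> [sfn a|H a].
    by apply/h; have [b [Cab ab]] := sfn a; exists a, b.
  have /h[i [j [ia Caj ij]]] := H a; exists j; split=> //.
  by apply: le_trans ij _; rewrite leU2.
split=> [d A C d' L e e_ce [aC hbt htb _ _]|].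
  have aC' := antitone_rconv aC.
  have [_ hSI hWO _ _] := aC.
  have Cbx x : Cbar C (\bot, x) by apply: hWO hbt (lex1 _).
  have Cxb x : Cbar C (x, \bot) by apply: hSI htb (lex1 _).
  have iff := rhd_le_rhd_pi_rhd_iff e_ce.
  split.
  - tfae.
    + move=> H; apply/(iff C C C) => // a b c Cab Cac.
      by apply: (H (c, b)); exists a.
    + move=> /(iff C C C aC aC aC) H.
      apply/(iff C (rconv C) C) => // a b c Cab Cac.
      exact: H Cac Cab.
    + move=> /(iff C (rconv C) C aC aC' aC) H [x y] [z /= Czx Czy].
      exact: H Czy Czx.
    + move=> H [x y] [z /= Czx Czy].
      by apply: (H (y, x)); exists z.
  - tfae.
    (* The first list is about right and the second about left Euclidean
       relations; both force [Cbar C] to be total, as [\bot] is related to every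
       element and every element to [\bot]. *)
    + move=> H; apply/(iff (rconv C) (rconv C) (rconv C)) => // a b c _ _.
      by apply: (H (b, c)); exists \bot; [exact: Cbx|exact: Cbx].
    + move=> /(iff _ _ _ aC' aC' aC') H.
      apply/(iff (rconv C) C (rconv C)) => // a b c Cba Cca.
      exact: H Cca Cba.
    + move=> /(iff _ _ _ aC' aC aC') H [x y] _.
      exact: (H \bot x y (Cxb x) (Cxb y)).
    + move=> H [x y] [z /= Czx Czy].
      by apply: (H (y, x)); exists z.
  - tfae.
    + move=> H; apply/(iff (rconv C) (rconv C) C) => // a b c Cba Cac.
      by apply: (H (b, c)); exists a.
    + move=> /(iff _ _ _ aC' aC' aC) H.
      apply/(iff C C (rconv C)) => // a b c Cab Cca.
      exact: H Cca Cab.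
    + move=> /(iff _ _ _ aC aC aC') H [x y] [z /= Czx Cyz].
      exact: H Czx Cyz.
    + move=> H [x y] [z /= Cxz Czy].
      by apply: (H (y, x)); exists z.
  - tfae.
    + move=> H; apply/(iff C (rconv C) (rconv C)) => // a b c Cab Cca.
      by apply: (H (c, b)); exists a.
    + move=> /(iff _ _ _ aC aC' aC') H.
      apply/(iff (rconv C) C C) => // a b c Cba Cac.
      exact: H Cac Cba.
    + move=> /(iff _ _ _ aC' aC aC) H [x y] [z /= Czx Cyz].
      exact: H Cyz Czx.
    + move=> H [x y] [z /= Cxz Czy].
      by apply: (H (y, x)); exists z.
split=> [d A C d' L e e_ce [aC _ _ _ _]|].
  have aC' := antitone_rconv aC.
  tfae.
  - by move=> H [x y] /(H (y, x)).
  - move=> H; apply/(rhd_le_rhd_iff e_ce C aC') => -[x y].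
    exact: (H (y, x)).
  - move=> /(rhd_le_rhd_iff e_ce C aC') H.
    by apply/(le_rhd_pi_rhd_iff e_ce aC aC) => a b /H.
  - move=> /(le_rhd_pi_rhd_iff e_ce aC aC) H.
    apply/(rhd_le_rhd_iff e_ce (rconv C) aC) => -[x y].
    exact: H.
  - move=> /(rhd_le_rhd_iff e_ce (rconv C) aC) H.
    apply/(le_rhd_pi_rhd_iff e_ce aC' aC') => a b.
    exact: (H (a, b)).
  - by move=> /(le_rhd_pi_rhd_iff e_ce aC' aC') H [x y] /H.
split=> [d A C d' L e e_ce [aC _ _ _ _]|].
  have [_ hSI _ _ _] := aC; have iC := ideal_rhd aC.
  have iK a : ideal ([set b | b <= a] `&` [set b | Cbar C (a, b)])%classic.
    by apply: idealI => //; exact: ideal_principal.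
  (* Both sides hold unconditionally. *)
  split=> [_ a|_ a b c Cab _]; last exact: hSI Cab (leIl _ _).
  have [K0 Kdir _] := iK a; rewrite meet_image_rhd//.
  apply/(le_rhd_pi_csup_iff e_ce aC _ K0 Kdir) => c [/= ca _].
  exact: rhd_anti.
split=> [d A C d' L e e_ce [aC _ _ _ _]|].
  have aC' := antitone_rconv aC; split; first exact: ALT_rhd_iff.
  exact: (ALT_rhd_iff e_ce aC').
move=> d A C d' L e e_ce [aC _ _ _ _] hA.
have aC' := antitone_rconv aC; have iC := ideal_rhd aC.
have iC' b : ideal [set a | Cbar C (a, b)] := ideal_rhd aC' b.
(* Both sides are joins of ideals: the left one of the [x] meeting the two premises, the right one
   of the [x] meeting the conclusion. *)
have h a b : rhd C e (a `|` b) `&` himp (e b) (rhd C e a)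
      <= himp (e a) (brhd C e b) <->
    forall x, Cbar C (a `|` b, x) -> Cbar C (a, b `&` x) -> Cbar C (a `&` x, b).
  rewrite !himp_image_csup// meet_csup_ideal//; last exact: ideal_himp.
  apply: iff_trans (csup_image_le_iff e_ce _ _) _.
  have iK := ideal_himp hA a (iC' b).
  split=> H x; first by move=> Cx Cax; apply/(le_csup_ideal_iff e_ce x iK)/H.
  by move=> [/= Cx Cax]; apply/(le_csup_ideal_iff e_ce x iK)/H.
split=> [H a b|H a x y Cx Cax]; first by apply/h => x; rewrite meetC; apply: H.
by apply: (h a y).1 => //; rewrite meetC.
Qed.
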